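(* We have: (a) $\mathfrak{g}_{\mathrm{DSO}}(6)=2$. (b) $\mathfrak{g}_{\mathrm{ODJM}}(6)=3$.
   Context: Write $\mathbb{R}_+ = (0,\infty)$. For $a \in \mathbb{R}_+^p$ and $v \in \mathbb{R}^p$ (here $p=6$), let $J_{a,v}(\theta)$, $\theta \in \mathbb{R}$, be the Hermitian $p\times p$ matrix with diagonal entries $v_1,\dots,v_p$, entries $a_1,\dots,a_{p-1}$ on the first super- and sub-diagonals (i.e. the $(j,j+1)$ and $(j+1,j)$ entries equal $a_j$ for $1\le j\le p-1$), $(1,p)$ entry $e^{-2\pi i \theta}a_p$, $(p,1)$ entry $e^{2\pi i\theta}a_p$, and all other entries zero. (These are the Floquet matrices of the periodic Jacobi matrix $[\mathbf{J}_{a,v}\psi](n) = A(n-1)\psi(n-1)+V(n)\psi(n)+A(n)\psi(n+1)$ on $\ell^2(\mathbb{Z})$, where $A,V$ are the $p$-periodic extensions of $a,v$.) Let $\lambda_1(\theta)\le\cdots\le\lambda_p(\theta)$ be the eigenvalues of $J_{a,v}(\theta)$ counted with multiplicity, and put $\lambda_j^- = \min_{\theta\in[0,1]}\lambda_j(\theta)$, $\lambda_j^+ = \max_{\theta\in[0,1]}\lambda_j(\theta)$. It is known that $\lambda_1^-<\lambda_1^+\le\lambda_2^-<\cdots\le\lambda_p^-<\lambda_p^+$. A number $\lambda\in\mathbb{R}$ is a closed gap of $(a,v)$ if $\lambda=\lambda_j^+=\lambda_{j+1}^-$ for some $1\le j\le p-1$. Let $\mathfrak{g}(a,v)$ be the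 number of closed gaps of $(a,v)$; put $\mathfrak{g}_{\mathrm{DSO}}(v)=\mathfrak{g}(\mathbf{1},v)$ for $v\in\mathbb{R}^p$, where $\mathbf{1}=(1,\dots,1)$, and $\mathfrak{g}_{\mathrm{ODJM}}(a)=\mathfrak{g}(a,\mathbf{0})$ for $a\in\mathbb{R}_+^p$, where $\mathbf{0}=(0,\dots,0)$. Let $\mathrm{cyc}(v_1,\dots,v_p)=(v_2,\dots,v_p,v_1)$. A vector $v \in \mathbb{R}^p$ is irreducible if $v,\mathrm{cyc}(v),\dots,\mathrm{cyc}^{p-1}(v)$ are pairwise distinct, and reducible otherwise. Define $\mathfrak{g}_{\mathrm{DSO}}(p)=\max\{\mathfrak{g}_{\mathrm{DSO}}(v): v\in\mathbb{R}^p \text{ irreducible}\}$ and $\mathfrak{g}_{\mathrm{ODJM}}(p)=\max\{\mathfrak{g}_{\mathrm{ODJM}}(a): a\in\mathbb{R}_+^p\text{ irreducible}\}$. *)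

(* Defs.v *)
From HB Require Import structures.
From mathcomp Require Import all_boot all_order all_algebra.
From mathcomp Require Import complex.
From mathcomp Require Import finmap.
From mathcomp Require Import all_classical all_reals all_analysis.

Set Implicit Arguments.
Unset Strict Implicit.
Unset Printing Implicit Defensive.

Import Order.TTheory GRing.Theory Num.Theory.
Import numFieldNormedType.Exports.

Local Open Scope classical_set_scope.
Local Open Scope ring_scope.
Local Open Scope complex_scope.

Section Extrema.
Context {d : Order.disp_t} {T : porderType d}.

Definition is_max (A : set T) (m : T) : Prop := A m /\ ubound A m.
Definition is_min (A : set T) (m : T) : Prop := A m /\ lbound A m.

End Extrema.

Section PeriodicJacobi.
Context {R : realType} {p : nat}.
Implicit Types (a v : 'rV[R]_p) (A : 'M[R[i]]_p) (t x : R) (j : nat).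

(* The phase exp (2 pi i t). *)
Definition phase t : R[i] := cos (2 * pi * t) +i* sin (2 * pi * t).

(* Indices run over 0, ..., p - 1.  For p >= 3 the five conditions below are
   mutually exclusive, so each entry is a single term of the sum. *)
Definition floquet a v t : 'M[R[i]]_p :=
  \matrix_(k, l)
    ((if k == l then (v 0 k)%:C else 0)
     + (if l == k.+1 :> nat then (a 0 k)%:C else 0)
     + (if k == l.+1 :> nat then (a 0 l)%:C else 0)
     + (if (k == 0 :> nat) && (l == p.-1 :> nat)
        then phase (- t) * (a 0 l)%:C else 0)
     + (if (k == p.-1 :> nat) && (l == 0 :> nat)
        then phase t * (a 0 k)%:C else 0)).

(* The roots of the characteristic polynomial, with multiplicity. *)
Definition spectrum A : seq R[i] :=
  sval (closed_field_poly_normal (char_poly A)).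

(* Only meant for Hermitian A: the spectrum is then real (see
   char_poly_eigenvalues) and taking real parts is the identification of real
   complex numbers with elements of R. *)
Definition eigenvalues A : seq R :=
  sort <=%R [seq complex.Re z | z <- spectrum A].

(* The j-th eigenvalue, counted from 0; the default of nth is used only when
   p <= j. *)
Definition band_function a v j t : R := (eigenvalues (floquet a v t))`_j.

Definition band a v j : set R :=
  [set band_function a v j t | t in `[0, 1]%classic].

Definition closed_gaps a v : set R :=
  [set x | exists j,
     [/\ (j.+1 < p)%N, is_max (band a v j) x & is_min (band a v j.+1) x]].

(* fset_set is the set itself on finite sets; closed_gaps is always finite, by
   finite_closed_gaps. *)
Definition num_closed_gaps a v : nat := #|` fset_set (closed_gaps a v)|%fset.

Definition g_DSO v : nat := num_closed_gaps (const_mx 1) v.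
Definition g_ODJM a : nat := num_closed_gaps a 0.

Definition cyc v : 'rV[R]_p := \row_(k < p) v 0 (ordS k).

Definition irreducible_vec v : Prop :=
  injective (fun k : 'I_p => iter k cyc v).

Definition positive_vec a : Prop := forall k, 0 < a 0 k.

Lemma finite_closed_gaps a v : finite_set (closed_gaps a v).
Proof.
apply: (@sub_finite_set _ _
  ((fun j => xget 0 [set x | is_max (band a v j) x]) @` `I_p)); last first.
  exact/finite_image/finite_II.
move=> x [j [jp [xB xub] _]]; exists j => /=; first exact: ltnW.
case: xgetP => [y _ [yB yub]|/(_ x)]; last by case.
by apply/eqP; rewrite eq_le xub// yub.
Qed.

Lemma phaseN t : phase (- t) = (phase t)^*.
Proof. by rewrite /phase mulrN cosN sinN. Qed.

Lemma floquet_hermitian a v t : floquet a v t \is hermsymmx.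
Proof.
apply/is_hermitianmxP; rewrite expr0 scale1r; apply/matrixP => k l.
pose c : R[i] -> R[i] := @conjc R.
have cE (x : R[i]) : Num.conj x = c x by [].
have cif (b : bool) (x : R[i]) :
  c (if b then x else 0) = if b then c x else 0 by case: b; rewrite /c ?rmorph0.
have cD (x y : R[i]) : c (x + y) = c x + c y by exact: rmorphD.
have cM (x y : R[i]) : c (x * y) = c x * c y by exact: rmorphM.
have cR (x : R) : c x%:C = x%:C by exact: conjc_real.
have cN u : phase (- u) = c (phase u) by exact: phaseN.
have cK (x : R[i]) : c (c x) = x by exact: conjcK.
move: c cE cif cD cM cR cN cK => c cE cif cD cM cR cN cK.
rewrite !mxE cE !cD !cif !cM !cN !cR cK.
rewrite [l == k]eq_sym -!addrA.
congr (_ + _); first by case: eqVneq => // ->.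
rewrite addrCA; congr (_ + (_ + _)).
by rewrite addrC ![(nat_of_ord l == _) && _]andbC.
Qed.

Lemma char_poly_eigenvalues A : A \is hermsymmx ->
  char_poly A = \prod_(x <- eigenvalues A) ('X - (x%:C)%:P).
Proof.
move=> Ah; set sp := spectral_diag A.
have spR k : sp 0 k \is Num.real.
  by have /mxOverP := hermitian_spectral_diag_real Ah; apply.
have AE : char_poly A = \prod_(k < p) ('X - (sp 0 k)%:P).
  have /orthomx_spectralP -> := hermitian_normalmx Ah.
  set P := spectralmx A; have Pu : P \in unitmx by exact: spectral_unit.
  transitivity (char_poly (diag_mx sp)); last first.
    rewrite char_poly_trig ?diag_mx_is_trig//.
    by apply: eq_bigr => k _; rewrite mxE eqxx.
  rewrite /char_poly /char_poly_mx !map_mxM.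
  set PX := map_mx polyC P; set PV := map_mx polyC (invmx P).
  have VP : PV *m PX = 1%:M by rewrite -map_mxM mulVmx// map_mx1.
  have {1}-> : 'X%:M = PV *m 'X%:M *m PX.
    by rewrite scalar_mxC -mulmxA VP mulmx1.
  by rewrite -mulmxBl -mulmxBr !det_mulmx mulrAC -det_mulmx VP det1 mul1r.
have spE : perm_eq (spectrum A) [seq sp 0 k | k <- enum 'I_p].
  apply: prod_XsubC_eq; rewrite big_map big_enum -AE /spectrum.
  case: closed_field_poly_normal => r /= rE; rewrite [RHS]rE.
  by rewrite (monicP (char_poly_monic A)) scale1r.
rewrite /eigenvalues (perm_big _ (permEl (perm_sort _ _))) big_map.
rewrite (perm_big _ spE) big_map big_enum AE.
by apply: eq_bigr => k _ /=; rewrite RRe_real.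
Qed.

End PeriodicJacobi.

(* Main.v *)
Require Import Defs.
From mathcomp Require Import all_boot all_order all_algebra.
From mathcomp Require Import complex finmap ring lra zify.
From mathcomp Require Import all_classical all_reals all_analysis.

(** Let x be a closed gap of (a, v). The characteristic polynomial of the
    Floquet matrix at the phase t is D - 2 A cos (2 pi t), where D does not
    depend on t and A is the product of the entries of a
    ([char_poly_floquet]). Therefore x is a double eigenvalue of one Floquet
    matrix ([closed_gap_double]). This matrix is Hermitian, so it has a
    two-dimensional eigenspace, and for each site there is an eigenvector that
    vanishes at this site. Following it from its zero in both directions
    around the period gives polynomial identities between x and the entries of
    a and v, one family for each site, in which the phase survives only as a
    sign s ([closed_gap_identities]): s = 1 for periodic and s = -1 for
    antiperiodic eigenvectors.

    For a = 1 one of the identities is quadratic in x. With s = -1 its leading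
    terms cancel, and two solutions already force a period 3 or 4 on v
    ([dso_antiperiodic_unique]). With s = 1 there are at most two solutions,
    and if there are two, a solution with s = -1 makes v reducible
    ([dso_mixed_gaps]). So there are at most two closed gaps.

    For v = 0 and x not 0 the identities determine x^2 when s is given, and if
    both signs occurred then a would have period 2 ([odjm_closed_gap_sqr]). So
    the closed gaps are among 0 and two opposite numbers.

    Both bounds are attained by explicit vectors whose characteristic
    polynomial factors at the periodic and the antiperiodic phase. That the
    double roots are closed gaps requires to locate the eigenvalues at all
    other phases. This is done by evaluating the signs of the polynomial at
    seven points: since it has six real roots, alternating signs determine how
    many roots lie on each side of these points ([alternating_interlace]). *)

Set Implicit Arguments.
Unset Strict Implicit.
Unset Printing Implicit Defensive.

Import Order.TTheory GRing.Theory Num.Theory.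

Local Open Scope classical_set_scope.
Local Open Scope ring_scope.
Local Open Scope complex_scope.

(** * Determinants of cyclic Jacobi matrices *)

(** Laplace expansion along the first row. An entry is None when it vanishes
    for structural reasons: such entries are skipped rather than multiplied by
    zero, which keeps the expansion of a sparse 6 x 6 determinant small. *)
Fixpoint sparse_det (T : nzRingType) (n : nat)
    (f : nat -> nat -> option T) : T :=
  if n is m.+1 then
    foldr (fun j s => if f 0%N j is Some x
      then (-1) ^+ j * x * sparse_det m (fun k l => f k.+1 (bump j l)) + s
      else s) 0 (iota 0 n)
  else 1.

Lemma det_sparse (T : comNzRingType) n (f : nat -> nat -> option T) :
  \det (\matrix_(k < n, l < n) odflt 0 (f k l)) = sparse_det n f.
Proof.
elim: n f => [|n IHn] f; first by rewrite det_mx00.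
rewrite (expand_det_row _ ord0).
transitivity (\sum_(0 <= j < n.+1) odflt 0 (f 0%N j) *
    ((-1) ^+ j * sparse_det n (fun k l => f k.+1 (bump j l)))).
  rewrite big_mkord; apply: eq_bigr => j _.
  rewrite mxE /cofactor add0n -IHn; congr (_ * (_ * \det _)).
  by apply/matrixP => k l; rewrite !mxE.
rewrite /index_iota subn0 unlock /sparse_det -/sparse_det.
elim: (iota 0 n.+1) => [|j r IHr] //=; rewrite IHr.
by case: (f 0%N _) => [x|] /=; rewrite ?mul0r ?add0r // mulrA [x * _]mulrC.
Qed.

Definition cyclic_jacobi_entry (T : nzRingType) (d b : nat -> T) (w w' : T)
    (k l : nat) : option T :=
  if k == l then Some (d k)
  else if l == k.+1 then Some (b k)
  else if k == l.+1 then Some (b l)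
  else if (k == 0) && (l == 5) then Some (w' * b 5%N)
  else if (k == 5) && (l == 0) then Some (w * b 5%N)
  else None.

(** The determinant of the tridiagonal block of n consecutive sites starting
    at site i, with diagonal d and off-diagonal b. *)
Fixpoint continuant (T : nzRingType) (d b : nat -> T) (n i : nat) : T :=
  match n with
  | 0 => 1
  | m.+1 => d i * continuant d b m i.+1 -
      (if m is l.+1 then b i ^+ 2 * continuant d b l i.+2 else 0)
  end.

(** In the Leibniz formula of a cyclic Jacobi determinant a permutation uses
    no corner entry, or both of them (which removes sites 0 and 5), or it is
    one of the two full cycles; these are the three terms. Hence the corner
    phases w and w^-1 enter only through their sum, here c. *)
Definition cyclic_det (T : nzRingType) (d b : nat -> T) (c : T) : T :=
  continuant d b 6 0 - b 5%N ^+ 2 * continuant d b 4 1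
  - c * (b 0%N * b 1%N * b 2%N * b 3%N * b 4%N * b 5%N).

Lemma det_cyclic_jacobi (T : comNzRingType) (d b : nat -> T) (w w' : T) :
  w * w' = 1 ->
  \det (\matrix_(k < 6, l < 6) odflt 0 (cyclic_jacobi_entry d b w w' k l)) =
    cyclic_det d b (w + w').
Proof. by move=> ww; rewrite det_sparse /cyclic_det /= /bump /=; ring: ww. Qed.

Lemma rmorph_continuant (T U : nzRingType) (f : {rmorphism T -> U})
    (d b : nat -> T) n i :
  f (continuant d b n i) = continuant (f \o d) (f \o b) n i.
Proof.
elim/ltn_ind: n i => -[|[|n]] IHn i /=; rewrite ?rmorph1 // rmorphB rmorphM.
  by rewrite rmorph1 rmorph0.
by rewrite !rmorphM -/(continuant d b n.+1 i.+1) !IHn.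
Qed.

Lemma rmorph_cyclic_det (T U : nzRingType) (f : {rmorphism T -> U})
    (d b : nat -> T) c :
  f (cyclic_det d b c) = cyclic_det (f \o d) (f \o b) (f c).
Proof.
by rewrite /cyclic_det -!rmorph_continuant /comp -rmorphXn -!rmorphM -!rmorphB.
Qed.

Lemma char_poly_cyclic_jacobi (T : comNzRingType) (d b : nat -> T) (w w' : T) :
  w * w' = 1 ->
  char_poly (\matrix_(k < 6, l < 6)
      odflt 0 (cyclic_jacobi_entry d b w w' k l)) =
  cyclic_det (fun n => 'X - (d n)%:P) (fun n => - (b n)%:P) (w + w')%:P.
Proof.
move=> ww'; rewrite polyCD -det_cyclic_jacobi -?polyCM ?ww' //.
congr (\det _); apply/matrixP => k l.
rewrite !mxE -val_eqE /cyclic_jacobi_entry /=.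
case: eqP => _ //=; rewrite mulr0n sub0r; do 2!case: eqP => _ //=.
do 2!(case: andP => _ /=; first by rewrite polyCM mulrN).
by rewrite polyC0 oppr0.
Qed.

(** * Locating roots by sign changes *)

(** Each factor c - z with z > c contributes one sign. *)
Lemma signed_prod_gt0 (R : realDomainType) (c : R) (s : seq R) :
  \prod_(z <- s) (c - z) != 0 ->
  0 < (-1) ^+ count (> c) s * \prod_(z <- s) (c - z).
Proof.
elim: s => [|z s IHs]; first by rewrite big_nil mulr1 expr0 ltr01.
rewrite big_cons mulf_eq0 negb_or => /andP[cz /IHs s0] /=.
rewrite exprD mulrACA pmulr_lgt0 //; move: cz; rewrite subr_eq0.
by case: (ltgtP c z) => //= cz _; rewrite ?expr0 ?expr1; move: cz; lra.
Qed.

Lemma lt_nth_count (R : realDomainType) (c : R) (s : seq R) k :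
  sorted <=%R s -> (k < size s)%N ->
  (c < s`_k) = (size s - k <= count (> c) s)%N.
Proof.
move=> s_sorted ks.
have sE : s = take k s ++ s`_k :: drop k.+1 s.
  by rewrite -drop_nth // cat_take_drop.
have le_s i j : (i <= j < size s)%N -> s`_i <= s`_j.
  case/andP=> ij js; apply: sorted_leq_nth => //; rewrite ?inE //.
    exact: le_trans. exact: leq_ltn_trans js.
have szd : size (drop k.+1 s) = (size s - k.+1)%N by rewrite size_drop.
rewrite {3}sE count_cat /=; have [ck|ck] := ltP c s`_k.
  rewrite -subnSK // -szd; symmetry.
  suff -> : count (> c) (drop k.+1 s) = size (drop k.+1 s) by exact: leq_addl.
  apply/eqP; rewrite -all_count; apply/(all_nthP 0) => i id.
  rewrite nth_drop (lt_le_trans ck) // le_s //; move: id; rewrite szd; lia.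
suff -> : count (> c) (take k s) = 0%N.
  rewrite !add0n; symmetry; apply/negbTE.
  rewrite -ltnNge (leq_ltn_trans (count_size _ _)) //.
  by rewrite szd subnS ltn_predL subn_gt0.
apply/eqP; rewrite eqn0Ngt -has_count; apply/(has_nthP 0) => -[j].
rewrite size_take ks => jk; rewrite nth_take // ltNge (le_trans _ ck) //.
by apply: le_s; rewrite (ltnW jk).
Qed.

(** A polynomial with n real roots which takes alternating signs at n + 1
    points has exactly one root in each gap. This is pure counting: the number
    of roots above the k-th point has the parity of n - k, it is nonincreasing
    in k and lies between 0 and n, so that it equals n - k. *)
Lemma alternating_interlace (R : realDomainType) (s c : seq R) :
  sorted <=%R s -> size c = (size s).+1 -> sorted <=%R c ->
  (forall k, (k <= size s)%N ->
     0 < (-1) ^+ (size s - k) * \prod_(z <- s) (c`_k - z)) ->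
  forall k, (k < size s)%N -> c`_k < s`_k <= c`_k.+1.
Proof.
move=> s_sorted sz_c c_sorted alt; set n := size s in sz_c alt *.
pose N k := count (> c`_k) s.
have N_parity k : (k <= n)%N -> odd (N k) = odd (n - k).
  move=> /alt P_gt0; have P0 : \prod_(z <- s) (c`_k - z) != 0.
    by apply: contraTneq P_gt0 => ->; rewrite mulr0 ltxx.
  have := mulr_gt0 P_gt0 (signed_prod_gt0 P0).
  rewrite mulrACA -expr2 pmulr_lgt0 ?exprn_even_gt0 ?P0 ?orbT //.
  rewrite -signr_odd -[X in _ * X]signr_odd -/(N k).
  by do 2!case: odd => //=; lra.
have N_mono k : (k < n)%N -> (N k.+1 <= N k)%N.
  move=> kn; apply: sub_count => z /=; apply: le_lt_trans.
  by apply: sorted_leq_nth c_sorted _ _ _ _ _ => //; rewrite ?inE ?sz_c;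
    do ?[exact: le_trans|lia].
have N_le k : (k <= n)%N -> (N k <= n - k)%N.
  elim: k => [|k IHk] kn; first by rewrite subn0 count_size.
  have := IHk (ltnW kn); have := N_mono _ kn; have := N_parity _ kn.
  by have := N_parity _ (ltnW kn); lia.
have N_ge k : (k <= n)%N -> (k <= N (n - k))%N.
  elim: k => // k IHk kn.
  have := IHk (ltnW kn); have := N_mono (n - k.+1)%N; rewrite subnSK //.
  have := N_parity (n - k)%N; have := N_parity (n - k.+1)%N.
  by rewrite !subKn //; lia.
move=> k kn.
rewrite lt_nth_count // -/n -/(N k) leNgt lt_nth_count // -/(N k.+1).
have := N_le k.+1 kn; have := N_ge _ (leq_subr k n).
rewrite subKn ?(ltnW kn) //.
by move=> -> le_N /=; rewrite -ltnNge (leq_ltn_trans le_N) //;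
  rewrite subnS ltn_predL subn_gt0.
Qed.

(** * Double eigenvalues of Hermitian matrices *)

Lemma char_poly_similar (F : fieldType) n (P A B : 'M[F]_n) :
  P \in unitmx -> P *m A = B *m P -> char_poly A = char_poly B.
Proof.
move=> Pu PA; pose PX := map_mx polyC P.
have dPX : \det PX != 0 by rewrite det_map_mx polyC_eq0 -unitfE -unitmxE.
have PXA : PX *m char_poly_mx A = char_poly_mx B *m PX.
  by rewrite mulmxBr mulmxBl -!map_mxM PA scalar_mxC.
by apply: (mulfI dPX); rewrite -det_mulmx PXA det_mulmx mulrC.
Qed.

Section Hermitian.
Context {R : realType} {n : nat}.
Implicit Types (A : 'M[R[i]]_n) (x : R).

Lemma size_eigenvalues A : A \is hermsymmx -> size (eigenvalues A) = n.
Proof.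
move=> /char_poly_eigenvalues /(congr1 (fun q : {poly R[i]} => size q)).
by rewrite size_char_poly size_prod_XsubC => -[].
Qed.

Lemma eigenvalues_sorted A : sorted <=%R (eigenvalues A).
Proof. exact: sort_le_sorted. Qed.

Lemma prod_eigenvalues A (q : {poly R}) : A \is hermsymmx ->
  char_poly A = map_poly (real_complex R) q ->
  \prod_(z <- eigenvalues A) ('X - z%:P) = q.
Proof.
move=> /char_poly_eigenvalues -> qE; apply: (map_poly_inj (real_complex R)).
rewrite -qE rmorph_prod /=; apply: eq_bigr => z _.
by rewrite rmorphB /= map_polyX map_polyC.
Qed.

Lemma sorted_prod_XsubC_inj (s1 s2 : seq R) :
  sorted <=%R s1 -> sorted <=%R s2 ->
  \prod_(z <- s1) ('X - z%:P) = \prod_(z <- s2) ('X - z%:P) -> s1 = s2.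
Proof.
by move=> h1 h2 /prod_XsubC_eq h; apply: (sorted_eq le_trans le_anti h1 h2 h).
Qed.

(** An eigenvalue of a Hermitian matrix with algebraic multiplicity two has
    two independent eigenvectors, and some combination of them vanishes at any
    prescribed coordinate. *)
Lemma double_eigenvalue_row A x j (m : 'I_n) : A \is hermsymmx ->
  (j.+1 < n)%N -> (eigenvalues A)`_j = x -> (eigenvalues A)`_j.+1 = x ->
  exists u : 'rV[R[i]]_n, [/\ u != 0, u 0 m = 0 & u *m A = x%:C *: u].
Proof.
move=> Ah jn xj xj1; set e := eigenvalues A in xj xj1.
have size_e : size e = n by exact: size_eigenvalues.
have /orthomx_spectralP AE := hermitian_normalmx Ah.
set P := spectralmx A in AE; set sp := spectral_diag A in AE.
have Pu : P \in unitmx by exact: spectral_unit.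
have PA : P *m A = diag_mx sp *m P.
  by rewrite [in LHS]AE -mulmxA mulKVmx.
have rowA k : row k P *m A = sp 0 k *: row k P.
  by rewrite -row_mul PA row_mul row_diag_mx -scalemxAl -rowE.
have charA : char_poly A = \prod_(k < n) ('X - (sp 0 k)%:P).
  rewrite (char_poly_similar Pu PA) char_poly_trig ?diag_mx_is_trig//.
  by apply: eq_bigr => k _; rewrite mxE eqxx.
have perm_sp : perm_eq [seq z%:C | z <- e] [seq sp 0 k | k <- enum 'I_n].
  apply: prod_XsubC_eq; rewrite big_map [RHS]big_map big_enum -charA.
  by rewrite (char_poly_eigenvalues Ah).
have : (1 < count_mem x%:C [seq sp 0%R k | k <- enum 'I_n])%N.
  rewrite -(permP perm_sp).
  rewrite -(cat_take_drop j e) (drop_nth 0) ?size_e ?(ltnW jn) //.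
  rewrite (drop_nth 0) ?size_e // xj xj1 map_cat count_cat /= eqxx.
  exact: leq_trans (leq_addl _ _).
rewrite count_map; set p := preim _ _; have -> : count p (enum 'I_n) = #|p|.
  by rewrite cardE -size_filter enumT.
case/card_gt1P => k [l [/eqP spk /eqP spl kl]].
have rowk : row k P *m A = x%:C *: row k P by rewrite rowA -spk.
have rowl : row l P *m A = x%:C *: row l P by rewrite rowA -spl.
have row0 i : row i P != 0.
  apply: contraTneq Pu => r0; rewrite -row_free_unit; apply/row_freePn.
  by exists i; rewrite r0 sub0mx.
have [Pkm|Pkm] := eqVneq (P k m) 0; first by exists (row k P); rewrite mxE.
(* The combination of the two eigenvectors that cancels the coordinate m. *)
exists (P k m *: row l P - P l m *: row k P); split; last 2 first.
- by rewrite !mxE mulrC subrr.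
- by rewrite mulmxBl -!scalemxAl rowk rowl scalerBr !scalerA ![_ * x%:C]mulrC.
apply: contraTneq Pu => /subr0_eq r0; rewrite -row_free_unit.
apply/row_freePn; exists l.
have -> : row l P = (P k m)^-1 *: (P l m *: row k P) by rewrite -r0 scalerK.
apply: scalemx_sub; apply: scalemx_sub.
case: (unliftP l k) kl => [i ->|-> /eqP //] _.
by rewrite row'Esub -row_rowsub row_sub.
Qed.
End Hermitian.

(** * Floquet matrices and closed gaps *)

Definition periodic_ext (T : Type) (u : 'rV[T]_6) (n : nat) : T :=
  u 0 (inord (n %% 6)).

Lemma periodic_extD6 (T : Type) (u : 'rV[T]_6) n :
  periodic_ext u (n + 6) = periodic_ext u n.
Proof. by rewrite /periodic_ext modnDr. Qed.

Lemma periodic_ext_ord (T : Type) (u : 'rV[T]_6) (k : 'I_6) :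
  periodic_ext u k = u 0 k.
Proof. by rewrite /periodic_ext modn_small // inord_val. Qed.

Local Notation "u ~ n" := (periodic_ext u n)
  (at level 2, n at level 2, format "u ~ n").

Section Floquet.
Context {R : realType}.
Implicit Types (a v : 'rV[R]_6) (t x c : R).

Lemma floquetE a v t k l :
  floquet a v t k l = odflt 0 (cyclic_jacobi_entry (fun n => (v~n)%:C)
    (fun n => (a~n)%:C) (phase t) (phase (- t)) k l).
Proof.
rewrite mxE -!periodic_ext_ord.
case: k => [[|[|[|[|[|[|k]]]]]] kp] //;
  case: l => [[|[|[|[|[|[|l]]]]]] lp] //=;
  by rewrite -?val_eqE /= ?addr0 ?add0r.
Qed.

Lemma phaseMN t : phase t * phase (- t) = 1.
Proof.
rewrite phaseN /phase; apply/eqP; rewrite eq_complex /=; apply/andP; split.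
  by rewrite mulrN opprK -!expr2 cos2Dsin2.
by rewrite mulrN [sin _ * _]mulrC addNr.
Qed.

Lemma phaseDN t : phase t + phase (- t) = (2 * cos (2 * pi * t))%:C.
Proof.
rewrite phaseN /phase; apply/eqP; rewrite eq_complex /= subrr eqxx andbT.
by apply/eqP; ring.
Qed.

(** With c the cosine of 2 pi t this is the characteristic polynomial. Up to
    the factor given by the product of the entries of a, it is the discriminant
    of the periodic Jacobi operator minus 2 c. *)
Definition floquet_poly a v c : {poly R} :=
  cyclic_det (fun n => 'X - (v~n)%:P) (fun n => - (a~n)%:P) (2 * c)%:P.

Lemma char_poly_floquet a v t :
  char_poly (floquet a v t) =
  map_poly (real_complex R) (floquet_poly a v (cos (2 * pi * t))).
Proof.
have -> : floquet a v t = \matrix_(k < 6, l < 6) odflt 0 (cyclic_jacobi_entry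
    (fun n => (v~n)%:C) (fun n => (a~n)%:C) (phase t) (phase (- t)) k l).
  by apply/matrixP => k l; rewrite floquetE mxE.
rewrite char_poly_cyclic_jacobi ?phaseMN // phaseDN rmorph_cyclic_det /=.
rewrite map_polyC /=.
congr cyclic_det; apply/funext => n /=.
  by rewrite rmorphB /= map_polyX map_polyC.
by rewrite rmorphN /= map_polyC.
Qed.

Lemma prod_eigenvalues_floquet a v t :
  \prod_(z <- eigenvalues (floquet a v t)) ('X - z%:P) =
  floquet_poly a v (cos (2 * pi * t)).
Proof. exact/prod_eigenvalues/char_poly_floquet/floquet_hermitian. Qed.

Lemma eigenvalues_floquet_eq a v t (s : seq R) : sorted <=%R s ->
  floquet_poly a v (cos (2 * pi * t)) = \prod_(z <- s) ('X - z%:P) ->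
  eigenvalues (floquet a v t) = s.
Proof.
move=> s_sorted; rewrite -prod_eigenvalues_floquet.
exact/sorted_prod_XsubC_inj/s_sorted/eigenvalues_sorted.
Qed.

Lemma band_mem a v j x : band a v j x ->
  exists2 t, 0 <= t <= 1 & (eigenvalues (floquet a v t))`_j = x.
Proof. by case=> t; rewrite /= in_itv => t01 <-; exists t. Qed.

Lemma periodic_ext_gt0 a : positive_vec a -> forall n, 0 < a~n.
Proof. by move=> a_gt0 n; exact: a_gt0. Qed.

Lemma eigenvalue_floquet_root a v t j : (j < 6)%N ->
  root (floquet_poly a v (cos (2 * pi * t))) (eigenvalues (floquet a v t))`_j.
Proof.
move=> j6; rewrite -prod_eigenvalues_floquet root_prod_XsubC mem_nth //.
by rewrite size_eigenvalues //; exact: floquet_hermitian.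
Qed.

(** The phase only shifts the polynomial by 2 c times the product of the
    off-diagonal entries, which does not vanish; so an energy determines the
    cosine of the phase at which it is an eigenvalue. *)
Lemma floquet_poly_root_inj a v x c c' : positive_vec a ->
  root (floquet_poly a v c) x -> root (floquet_poly a v c') x -> c = c'.
Proof.
move=> a_gt0; set A := a~0 * a~1 * a~2 * a~3 * a~4 * a~5.
have A_gt0 : 0 < A by rewrite /A !mulr_gt0 // periodic_ext_gt0.
have E y : (floquet_poly a v y).[x] = (floquet_poly a v 0).[x] - 2 * y * A.
  rewrite /floquet_poly /cyclic_det mulr0 mul0r subr0.
  rewrite [LHS]hornerD hornerN !(hornerM, hornerN, hornerC) /A.
  by congr (_ - _); ring.
rewrite /root (E c) (E c') => /eqP h /eqP h'.
by apply: (mulIf (lt0r_neq0 A_gt0)); lra.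
Qed.

(** At a closed gap x is the value of two consecutive band functions, a priori
    at different phases. Both phases have the same cosine because x is a root
    at both, hence the same eigenvalues, and x is a double eigenvalue. *)
Lemma closed_gap_double a v x : positive_vec a -> closed_gaps a v x ->
  exists t j, [/\ (j.+1 < 6)%N, (eigenvalues (floquet a v t))`_j = x &
    (eigenvalues (floquet a v t))`_j.+1 = x].
Proof.
move=> a_gt0 [j [j6 [/band_mem[t _ tx] _] [/band_mem[t' _ t'x] _]]].
exists t, j; split; [exact: j6|exact: tx|].
have cosE : cos (2 * pi * t) = cos (2 * pi * t').
  apply: (floquet_poly_root_inj (v := v) (x := x)) => //.
    by rewrite -tx eigenvalue_floquet_root // ltnW.
  by rewrite -t'x eigenvalue_floquet_root.
rewrite (@eigenvalues_floquet_eq a v t (eigenvalues (floquet a v t'))) //.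
  exact: eigenvalues_sorted.
by rewrite prod_eigenvalues_floquet cosE.
Qed.

Lemma closed_gapI a v x j t0 : (j.+1 < 6)%N -> 0 <= t0 <= 1 ->
  (eigenvalues (floquet a v t0))`_j = x ->
  (eigenvalues (floquet a v t0))`_j.+1 = x ->
  (forall t, (eigenvalues (floquet a v t))`_j <= x
     <= (eigenvalues (floquet a v t))`_j.+1) ->
  closed_gaps a v x.
Proof.
move=> j6 t01 xj xj1 le_x; exists j; split=> //; split.
- by exists t0; rewrite /= ?in_itv.
- by move=> _ [t _ <-]; have /andP[] := le_x t.
- by exists t0; rewrite /= ?in_itv.
- by move=> _ [t _ <-]; have /andP[] := le_x t.
Qed.

End Floquet.

(** * Bloch solutions at a closed gap *)

(** A solution psi of the three-term recurrence that vanishes at 0 is computed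
    forwards from psi 1, and, if it vanishes at 6 as well, backwards from psi
    7. The identities compare both computations at 3, 4 and 5, after division
    by psi 1. *)
Lemma shooting_identities (F : fieldType) (b y psi : nat -> F) (s : F) :
  (forall n, b n * psi n + b n.+1 * psi n.+2 = y n.+1 * psi n.+1) ->
  psi 0%N = 0 -> psi 6%N = 0 -> psi 7%N = s * psi 1%N -> psi 1%N != 0 ->
  [/\ b 3%N * b 4%N * b 5%N * (y 1%N * y 2%N - b 1%N ^+ 2) =
        - s * (b 6%N * b 1%N * b 2%N * (y 4%N * y 5%N - b 4%N ^+ 2)),
      b 4%N * b 5%N * (y 1%N * y 2%N * y 3%N - b 1%N ^+ 2 * y 3%N
         - b 2%N ^+ 2 * y 1%N) =
        - s * (b 6%N * b 1%N * b 2%N * b 3%N * y 5%N) &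
      b 5%N ^+ 2 * (y 4%N * (y 1%N * y 2%N * y 3%N - b 1%N ^+ 2 * y 3%N
         - b 2%N ^+ 2 * y 1%N) - b 3%N ^+ 2 * (y 1%N * y 2%N - b 1%N ^+ 2)) =
        - s * (b 6%N * b 1%N * b 2%N * b 3%N * b 4%N * b 5%N)].
Proof.
move=> rec psi0 psi6 psi7 psi1.
have fwd n : b n.+1 * psi n.+2 = y n.+1 * psi n.+1 - b n * psi n.
  by rewrite -rec addrC addKr.
have bwd n : b n * psi n = y n.+1 * psi n.+1 - b n.+1 * psi n.+2.
  by rewrite -rec addrK.
have f2 : b 1%N * psi 2%N = y 1%N * psi 1%N by rewrite fwd psi0 mulr0 subr0.
have f3 : b 1%N * b 2%N * psi 3%N = (y 1%N * y 2%N - b 1%N ^+ 2) * psi 1%N.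
  by rewrite -mulrA fwd mulrBr mulrCA f2; ring.
have f4 : b 1%N * b 2%N * b 3%N * psi 4%N =
    (y 1%N * y 2%N * y 3%N - b 1%N ^+ 2 * y 3%N - b 2%N ^+ 2 * y 1%N) * psi 1%N.
  by rewrite -mulrA fwd mulrBr mulrCA f3; ring: f2.
have f5 : b 1%N * b 2%N * b 3%N * b 4%N * psi 5%N =
    (y 4%N * (y 1%N * y 2%N * y 3%N - b 1%N ^+ 2 * y 3%N - b 2%N ^+ 2 * y 1%N)
     - b 3%N ^+ 2 * (y 1%N * y 2%N - b 1%N ^+ 2)) * psi 1%N.
  by rewrite -mulrA fwd mulrBr mulrCA f4; ring: f3.
have g5 : b 5%N * psi 5%N = - s * b 6%N * psi 1%N.
  by rewrite bwd psi6 psi7; ring.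
have g4 : b 4%N * b 5%N * psi 4%N = - s * b 6%N * y 5%N * psi 1%N.
  by rewrite mulrAC bwd psi6 mulr0 subr0 mulrAC -mulrA g5; ring.
have g3 : b 3%N * b 4%N * b 5%N * psi 3%N =
    - s * b 6%N * (y 4%N * y 5%N - b 4%N ^+ 2) * psi 1%N.
  have -> : b 3%N * b 4%N * b 5%N * psi 3%N =
      b 4%N * b 5%N * (b 3%N * psi 3%N) by ring.
  rewrite bwd; transitivity (y 4%N * (b 4%N * b 5%N * psi 4%N)
    - b 4%N ^+ 2 * (b 5%N * psi 5%N)); first by ring.
  by rewrite g4 g5; ring.
split; apply: (mulIf psi1).
- transitivity (b 1%N * b 2%N * (b 3%N * b 4%N * b 5%N * psi 3%N)).
    by rewrite -[LHS]mulrA -f3; ring.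
  by rewrite g3; ring.
- transitivity (b 1%N * b 2%N * b 3%N * (b 4%N * b 5%N * psi 4%N)).
    by rewrite -[LHS]mulrA -f4; ring.
  by rewrite g4; ring.
- transitivity (b 1%N * b 2%N * b 3%N * b 4%N * b 5%N * (b 5%N * psi 5%N)).
    by rewrite -[LHS]mulrA -f5; ring.
  by rewrite g5; ring.
Qed.

Section Bloch.
Context {R : realType}.
Implicit Types (a v : 'rV[R]_6) (t x c : R).

(** The quasi-periodic extension with multiplier s, which turns the
    eigenvector equation of a Floquet matrix into one recurrence without
    boundary cases. *)
Definition bloch_ext (u : 'rV[R[i]]_6) (s : R[i]) (n : nat) : R[i] :=
  s ^+ (n %/ 6) * u~n.

Lemma bloch_ext_small u s n : (n < 6)%N -> bloch_ext u s n = u~n.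
Proof. by move=> n6; rewrite /bloch_ext divn_small // mul1r. Qed.

Lemma periodic_extMD (T : Type) (u : 'rV[T]_6) q n : u~(q * 6 + n) = u~n.
Proof. by rewrite /periodic_ext modnMDl. Qed.

Lemma bloch_extMD u s q n :
  bloch_ext u s (q * 6 + n) = s ^+ q * bloch_ext u s n.
Proof. by rewrite /bloch_ext periodic_extMD divnMDl // exprD mulrA. Qed.

Lemma bloch_ext_rec a v t x (u : 'rV_6) :
  u *m floquet a v t = x%:C *: u ->
  let psi := bloch_ext u (phase (- t)) in
  forall n, (a~n)%:C * psi n + (a~n.+1)%:C * psi n.+2 =
    (x - v~n.+1)%:C * psi n.+1.
Proof.
move=> /rowP uH psi.
have {}uH (l : 'I_6) : \sum_(k < 6) u~k * odflt 0 (cyclic_jacobi_entry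
    (fun n => (v~n)%:C) (fun n => (a~n)%:C) (phase t) (phase (- t)) k l)
    = x%:C * u~l.
  move: (uH l); rewrite [RHS]mxE periodic_ext_ord => <-; rewrite mxE.
  by apply: eq_bigr => k _; rewrite periodic_ext_ord floquetE.
have psi6 k : psi (6 + k)%N = phase (- t) * psi k.
  by rewrite -[6%N]mul1n /psi bloch_extMD expr1.
have rec n : (n < 6)%N -> (a~n)%:C * psi n + (a~n.+1)%:C * psi n.+2 =
    (x - v~n.+1)%:C * psi n.+1.
  have uHn := uH (inord (n.+1 %% 6)).
  rewrite rmorphB /= mulrBl; move: uHn.
  case: n => [|[|[|[|[|[|//]]]]]] + _; rewrite inordK // !big_ord_recl big_ord0;
    rewrite /= /bump /= !(add1n, addn0) /=.
  1-4: by rewrite /psi !bloch_ext_small // => <-; ring.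
    by rewrite (psi6 0%N) /psi !bloch_ext_small // => <-; ring.
  rewrite (psi6 0%N) (psi6 1%N) modnn.
  rewrite (periodic_extMD a 1 0 : a~6 = _) (periodic_extMD v 1 0 : v~6 = _).
  rewrite /psi !bloch_ext_small //= => h.
  rewrite [x%:C * _]mulrCA -h; ring: (phaseMN t).
move=> n; rewrite (divn_eq n 6).
move: (n %/ 6)%N (n %% 6)%N (ltn_pmod n (isT : 0 < 6)%N) => q r r6.
rewrite -(addnS _ r) -(addnS _ r.+1) /psi !bloch_extMD !periodic_extMD.
by rewrite !(mulrCA _ (_ ^+ q)) -mulrDr rec.
Qed.

Lemma bloch_ext_zero a v t x (u : 'rV_6) m : positive_vec a ->
  u *m floquet a v t = x%:C *: u ->
  let psi := bloch_ext u (phase (- t)) in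
  psi m = 0 -> psi m.+1 = 0 -> u = 0.
Proof.
move=> a_gt0 /bloch_ext_rec rec psi psim psim1.
(* Two consecutive zeros propagate to the right, and quasi-periodicity brings
   every site to the right of m. *)
have psi0 k : psi (m + k)%N = 0 /\ psi (m + k).+1 = 0.
  elim: k => [|k [IH0 IH1]]; first by rewrite addn0.
  rewrite addnS; split=> //.
  have := rec (m + k)%N; rewrite -/psi IH0 IH1 !mulr0 add0r => /eqP.
  by rewrite mulf_eq0 fmorph_eq0 (gt_eqF (periodic_ext_gt0 a_gt0 _)) /= => /eqP.
apply/rowP => k; rewrite mxE -periodic_ext_ord.
have [] := psi0 (5 * m + k)%N.
rewrite addnA -mulSn mulnC /psi bloch_extMD bloch_ext_small // => /eqP + _.
rewrite mulf_eq0 expf_eq0 => /orP[/andP[_ /eqP p0]|/eqP //].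
by have := phaseMN t; rewrite p0 mulr0 => /eqP; rewrite eq_sym oner_eq0.
Qed.

(** At a closed gap there is, for every site n, a Bloch solution that vanishes
    at n, so the shooting identities hold at every site. The last of them says
    that the multiplier is real, so it is a sign s; the other two then become
    real equations. They are entries of the matrix equation saying that half
    of the period has a transfer matrix equal to s times the inverse of the
    transfer matrix of the other half. *)
Lemma closed_gap_identities a v x : positive_vec a -> closed_gaps a v x ->
  exists s : R, (s = 1 \/ s = - 1) /\ forall n, let y k := x - v~(n + k) in
    let b k := a~(n + k) in
    b 3%N * b 4%N * b 5%N * (y 1%N * y 2%N - b 1%N ^+ 2) =
      - s * (b 0%N * b 1%N * b 2%N * (y 4%N * y 5%N - b 4%N ^+ 2)) /\
    b 4%N * b 5%N * (y 1%N * y 2%N * y 3%N - b 1%N ^+ 2 * y 3%N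
         - b 2%N ^+ 2 * y 1%N) =
      - s * (b 0%N * b 1%N * b 2%N * b 3%N * y 5%N).
Proof.
move=> a_gt0 /(closed_gap_double a_gt0)[t [j [j6 tx tx1]]].
set w := phase (- t).
have idC n : let y k := (x - v~(n + k))%:C in let b k := (a~(n + k))%:C in
  [/\ b 3%N * b 4%N * b 5%N * (y 1%N * y 2%N - b 1%N ^+ 2) =
        - w * (b 6%N * b 1%N * b 2%N * (y 4%N * y 5%N - b 4%N ^+ 2)),
      b 4%N * b 5%N * (y 1%N * y 2%N * y 3%N - b 1%N ^+ 2 * y 3%N
         - b 2%N ^+ 2 * y 1%N) =
        - w * (b 6%N * b 1%N * b 2%N * b 3%N * y 5%N) &
      b 5%N ^+ 2 * (y 4%N * (y 1%N * y 2%N * y 3%N - b 1%N ^+ 2 * y 3%N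
         - b 2%N ^+ 2 * y 1%N) - b 3%N ^+ 2 * (y 1%N * y 2%N - b 1%N ^+ 2)) =
        - w * (b 6%N * b 1%N * b 2%N * b 3%N * b 4%N * b 5%N)].
  move=> y b; have [u [u0 um uH]] := double_eigenvalue_row
    (inord (n %% 6)) (floquet_hermitian a v t) j6 tx tx1.
  pose psi k := bloch_ext u w (n + k).
  have psi0 : psi 0%N = 0.
    by rewrite /psi addn0 /bloch_ext /periodic_ext um mulr0.
  have psi6 k : psi (6 + k)%N = w * psi k.
    by rewrite /psi addnCA -{1}[6%N]mul1n bloch_extMD expr1.
  apply: (@shooting_identities _ b y psi) => [k||||].
  - by rewrite /b /y /psi !addnS; exact: bloch_ext_rec uH _.
  - exact: psi0.
  - by rewrite (psi6 0%N) psi0 mulr0.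
  - exact: (psi6 1%N).
  apply: contraNneq u0 => psi1; apply/eqP.
  apply: (bloch_ext_zero a_gt0 uH (m := n)); first by rewrite -[n]addn0.
  by rewrite -addn1.
(* The third identity writes w times a positive real as a real number. *)
pose s := cos (2 * pi * - t).
have sw : sin (2 * pi * - t) = 0.
  have [_ _] := idC 0%N.
  rewrite -!(rmorphM, rmorphXn, rmorphB) /= => /(congr1 (@complex.Im R)).
  rewrite /w /phase /= mulr0 add0r => /eqP.
  rewrite eq_sym mulf_eq0 oppr_eq0 [X in _ || X]gt_eqF ?orbF.
    by move/eqP.
  by rewrite !mulr_gt0 // periodic_ext_gt0.
have wE : w = s%:C by rewrite /w /phase sw.
have sE : s = 1 \/ s = - 1.
  have := cos2Dsin2 (2 * pi * - t); rewrite sw -/s expr0n addr0 => /eqP.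
  by rewrite sqrf_eq1 => /orP[] /eqP; [left|right].
exists s; split=> // n y b.
have b6 : a~(n + 6) = b 0%N by rewrite periodic_extD6 /b addn0.
have [] := idC n; rewrite wE b6 => idA idB _.
split; apply: (fmorph_inj (real_complex R)).
  move: idA; rewrite -!(rmorphM, rmorphN, rmorphXn, rmorphB) //.
move: idB; rewrite -!(rmorphM, rmorphN, rmorphXn, rmorphB) //.
Qed.
End Bloch.

(** * Upper bounds *)

Lemma card_fset_set_le (T : choiceType) (A : set T) n : finite_set A ->
  (forall s : seq T, uniq s -> {in s, forall x, A x} -> (size s <= n)%N) ->
  (#|` fset_set A| <= n)%N.
Proof.
by move=> A_fin; apply; [exact: fset_uniq|move=> x; rewrite in_fset_set // inE].
Qed.

Lemma card_fset_set_ge (T : choiceType) (A : set T) (s : seq T) :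
  finite_set A -> uniq s -> {in s, forall x, A x} ->
  (size s <= #|` fset_set A|)%N.
Proof.
move=> A_fin s_uniq sA; apply: uniq_leq_size => // x /sA Ax.
by rewrite in_fset_set // inE.
Qed.

Section UpperBounds.
Context {R : realType}.
Implicit Types (a v : 'rV[R]_6) (s x z : R).

Lemma periodic_ext_iter_cyc v k n : (iter k cyc v)~n = v~(n + k).
Proof.
elim: k n => [|k IHk] n; first by rewrite addn0.
rewrite iterS addnS -addSn -IHk {1}/periodic_ext mxE -periodic_ext_ord.
rewrite /= inordK ?ltn_mod // /periodic_ext; congr (_ 0 (inord _)).
by rewrite modn_mod -addn1 modnDml addn1.
Qed.

Lemma periodic_ext_inj v v' : (forall n, v~n = v'~n) -> v = v'.
Proof. by move=> vv'; apply/rowP => k; rewrite -!periodic_ext_ord. Qed.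

Lemma irreducible_vec_period v k : (0 < k < 6)%N ->
  (forall n, v~(n + k) = v~n) -> ~ irreducible_vec v.
Proof.
move=> /andP[k0 k6] vk /(_ ord0 (Ordinal k6)) => /(_ _)/(congr1 val) /= E.
suff /E h : v = iter k cyc v by rewrite -h in k0.
by apply: periodic_ext_inj => n; rewrite periodic_ext_iter_cyc.
Qed.

(** For a = 1, two entries of the equation between the transfer matrix of half
    a period and s times the inverse of that of the other half. *)
Definition dso_half_turn v s x := forall n, let y k := x - v~(n + k) in
  y 0%N * y 1%N - 1 = - s * (y 3%N * y 4%N - 1) /\
  y 0%N * y 1%N * y 2%N - y 2%N - y 0%N = - s * y 4%N.

Lemma dso_closed_gap v x : closed_gaps (const_mx 1) v x ->
  dso_half_turn v 1 x \/ dso_half_turn v (- 1) x.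
Proof.
case/closed_gap_identities => [k|s [s1 ids]]; first by rewrite mxE ltr01.
suff : dso_half_turn v s x by case: s1 => ->; [left|right].
move=> n y.
have ext1 k : (const_mx 1 : 'rV[R]_6)~k = 1 by rewrite /periodic_ext mxE.
(* The identities at n involve v at the sites n + 1, ..., n + 5, so those at
   n + 5 involve it, up to periodicity, at n, ..., n + 4. *)
have yE k : x - v~(n + 5 + k.+1) = y k.
  by rewrite (_ : n + 5 + k.+1 = n + k + 6)%N ?periodic_extD6 //; lia.
by have := ids (n + 5)%N; rewrite /= !ext1 !yE !(mul1r, mulr1) expr1n !mul1r.
Qed.

(** For s = -1 the first identity says that (x - v_n)(x - v_(n+1)) agrees with
    (x - v_(n+3))(x - v_(n+4)). Both are monic of degree two in x, so agreement
    at two energies forces the pairs of roots to agree. The difference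
    v_n - v_(n+3) then alternates in sign: either it vanishes, which is
    period 3, or v_n = v_(n+4) for all n, which is period 4. *)
Lemma dso_antiperiodic_unique v x x' : irreducible_vec v ->
  dso_half_turn v (- 1) x -> dso_half_turn v (- 1) x' -> x = x'.
Proof.
move=> v_irr hx hx'; apply/eqP; apply: contraPT v_irr => xx'.
have sumE n : v~n + v~(n + 1) = v~(n + 3) + v~(n + 4).
  have [h _] := hx n; have [h' _] := hx' n.
  move: h h' => /=; rewrite addn0 => h h'.
  have nz : x - x' != 0 by rewrite subr_eq0.
  by apply: (mulfI nz); lra.
have prodE n : (v~n - v~(n + 3)) * (v~n - v~(n + 4)) = 0.
  have [h _] := hx n; move: h (sumE n) => /=; rewrite addn0; nra.
have d_alt n : v~(n + 1) - v~(n + 4) = - (v~n - v~(n + 3)).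
  by have := sumE n; lra.
have [d0|d0] := eqVneq (v~0) (v~3).
  have d n : v~(n + 3) = v~n.
    by elim: n => [//|n IHn]; have := d_alt n; rewrite addn1 addSnnS IHn; lra.
  exact: (irreducible_vec_period (k := 3)) d.
have d n : v~n - v~(n + 3) != 0.
  elim: n => [|n IHn]; first by rewrite subr_eq0.
  by rewrite addSnnS -addn1 d_alt oppr_eq0.
apply: (irreducible_vec_period (k := 4)) => // n.
by have := prodE n; move/eqP; rewrite mulf_eq0 (negPf (d n)) subr_eq0 => /eqP.
Qed.

(** For s = 1 the first identity is a quadratic equation in the energy with
    leading coefficient 2, so two solutions determine its linear coefficient. *)
Lemma dso_periodic_sum v x x' n : x != x' ->
  dso_half_turn v 1 x -> dso_half_turn v 1 x' ->
  v~n + v~(n + 1) + v~(n + 3) + v~(n + 4) = 2 * (x + x').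
Proof.
move=> xx' /(_ n) /= [+ _] /(_ n) /= [+ _]; rewrite addn0 => h h'.
have nz : x - x' != 0 by rewrite subr_eq0.
by apply: (mulfI nz); lra.
Qed.

(** Two energies with s = 1 make v_n + v_(n+3) constant. Centering at half of
    that constant, v_n = h + d_n with d_(n+3) = - d_n, leaves the equations
    d_n d_(n+1) = const. The third energy z then either forces
    d_(n+1) = - d_n, which is period 2, or is the center h, in which case its second identity, a cubic
    equation, forces d to vanish. *)
Lemma dso_mixed_gaps v x x' z : irreducible_vec v -> x != x' ->
  dso_half_turn v 1 x -> dso_half_turn v 1 x' -> ~ dso_half_turn v (- 1) z.
Proof.
move=> v_irr xx' hx hx' hz.
have v3 n : v~(n + 3) = x + x' - v~n.
  have s0 := dso_periodic_sum n xx' hx hx'.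
  have s1 := dso_periodic_sum (n + 1) xx' hx hx'.
  have s2 := dso_periodic_sum (n + 2) xx' hx hx'.
  move: s0 s1 s2; rewrite -!addnA !periodic_extD6; lra.
pose h := (x + x') / 2; pose d n := v~n - h; pose e := x - h; pose f := z - h.
have vE n : v~n = h + d n by rewrite /d addrC subrK.
have d3 n : d (n + 3)%N = - d n by rewrite /d v3 /h; lra.
have v4 n : v~(n + 4) = h - d n.+1.
  by rewrite (_ : n + 4 = n.+1 + 3)%N ?vE ?d3 // addSnnS.
have prodE n : d n * d n.+1 = 1 - e ^+ 2.
  have [+ _] := hx n; rewrite /= addn0 v4 [v~(n + 3)]vE d3 addn1 !vE.
  rewrite -/(x - h) /e; nra.
have fE n : f * (d n + d n.+1) = 0.
  have [+ _] := hz n; rewrite /= addn0 v4 [v~(n + 3)]vE d3 addn1 !vE /f; nra.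
have [f0|f0] := eqVneq f 0; last first.
  have d1 n : d n.+1 = - d n.
    by move: (fE n) => /eqP; rewrite mulf_eq0 (negPf f0) addrC addr_eq0 => /eqP.
  apply: (irreducible_vec_period (k := 2)) v_irr => // n.
  by rewrite !vE addn2 !d1 opprK.
have cubE n : d n + d n.+2 - d n.+1 = d n * d n.+1 * d n.+2.
  have zE : z = h by apply/eqP; rewrite -subr_eq0 -/f f0.
  have [_] := hz n; rewrite /= addn0 v4 addn1 addn2 !vE zE; lra.
(* The case d_n = d_(n+2) = - d_(n+1) leaves the equation 3 d_n = - d_n^3,
   whose only real solution is 0. *)
have d0 n : d n = 0.
  have e1 : d n.+1 * (d n - d n.+2) = 0.
    by have := prodE n; have := prodE n.+1; lra.
  have e2 : d n.+2 * (d n.+1 + d n) = 0.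
    have := prodE n.+1; have := prodE n.+2.
    by have := d3 n; rewrite addn3 => ->; lra.
  have := cubE n; move: e1 e2 => /eqP + /eqP; rewrite !mulf_eq0.
  case/orP => /eqP e1 /orP[] /eqP e2; move: e1 e2; nra.
by apply: (irreducible_vec_period (k := 1)) v_irr => // n; rewrite !vE !d0.
Qed.

(** Three energies with s = 1 would be three roots of one quadratic equation,
    and the other distributions of signs are excluded by the preceding lemmas. *)
Lemma g_DSO_le2 v : irreducible_vec v -> (g_DSO v <= 2)%N.
Proof.
move=> v_irr; apply: card_fset_set_le; first exact: finite_closed_gaps.
case=> [|x [|y [|z s]]] //= /and3P[]; rewrite !inE !negb_or.
case/and3P=> xy xz _ /andP[yz _] _ gaps; exfalso.
have {gaps} gap w : w \in [:: x; y; z] ->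
    dso_half_turn v 1 w \/ dso_half_turn v (-1) w.
  move=> ws; apply/dso_closed_gap/gaps; move: ws; rewrite !inE.
  by case/or3P => ->; rewrite ?orbT.
have anti w w' : w != w' ->
    dso_half_turn v (- 1) w -> ~ dso_half_turn v (- 1) w'.
  move=> /eqP ww' hw hw'; apply: ww'.
  exact: dso_antiperiodic_unique v_irr hw hw'.
have mixed w w' u := dso_mixed_gaps (x := w) (x' := w') (z := u) v_irr.
have [gx gy gz] : [/\ dso_half_turn v 1 x \/ dso_half_turn v (-1) x,
    dso_half_turn v 1 y \/ dso_half_turn v (-1) y &
    dso_half_turn v 1 z \/ dso_half_turn v (-1) z].
  by split; apply: gap; rewrite !inE eqxx ?orbT.
case: gx gy gz => [px|ax] [py|ay] [pz|az]; last 4 first.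
- exact: mixed yz py pz ax.
- exact: anti xz ax az.
- exact: anti xy ax ay.
- exact: anti xy ax ay.
- have := dso_periodic_sum 0 xy px py; rewrite (dso_periodic_sum 0 xz px pz).
  by move=> h; case/eqP: yz; lra.
- exact: mixed xy px py az.
- exact: mixed xz px pz ay.
- exact: anti yz ay az.
Qed.

(** Without a potential the second identity has a factor x. *)
Lemma odjm_closed_gap a x : positive_vec a -> closed_gaps a 0 x -> x != 0 ->
  exists s, (s = 1 \/ s = - 1) /\ forall n,
    a~(n + 3) * a~(n + 4) * (x ^+ 2 - a~n ^+ 2 - a~n.+1 ^+ 2) =
    - s * (a~(n + 5) * a~n * a~n.+1 * a~(n + 2)).
Proof.
move=> a_gt0 /(closed_gap_identities a_gt0)[s [s1 ids]] x0.
exists s; split=> // n; apply: (mulIf x0).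
have ext0 k : (0 : 'rV[R]_6)~k = 0 by rewrite /periodic_ext mxE.
have aE k : a~(n + 5 + k.+1) = a~(n + k).
  by rewrite (_ : n + 5 + k.+1 = n + k + 6)%N ?periodic_extD6 //; lia.
have [_] := ids (n + 5)%N; rewrite /= !ext0 !aE subr0 !addn0 addn1; lra.
Qed.

(** Two nonzero closed gaps with the same sign have the same square, since the
    identity is linear in x^2. For opposite signs the right-hand sides cancel
    in the sum, which says that a_n^2 + a_(n+1)^2 is independent of n, and a
    would have period 2. *)
Lemma odjm_closed_gap_sqr a x x' : positive_vec a -> irreducible_vec a ->
  closed_gaps a 0 x -> closed_gaps a 0 x' -> x != 0 -> x' != 0 ->
  x ^+ 2 = x' ^+ 2.
Proof.
move=> a_gt0 a_irr gx gx' x0 x'0.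
have ext_gt0 := periodic_ext_gt0 a_gt0.
have [s [s1 hx]] := odjm_closed_gap a_gt0 gx x0.
have [s' [s'1 hx']] := odjm_closed_gap a_gt0 gx' x'0.
have nz n : a~(n + 3) * a~(n + 4) != 0 by rewrite mulf_neq0 // gt_eqF.
have [ss'|ss'] := eqVneq s s'.
  by have := hx 0%N; have := hx' 0%N; rewrite ss' => <- /(mulfI (nz 0%N)); lra.
exfalso; apply: (irreducible_vec_period (k := 2)) a_irr => // n.
have sumE m : x ^+ 2 + x' ^+ 2 = 2 * (a~m ^+ 2 + a~m.+1 ^+ 2).
  have := hx m; have := hx' m.
  have -> : s' = - s by case: s1 s'1 ss' => -> [] ->; rewrite ?eqxx ?opprK.
  by move=> h' h; apply: (mulfI (nz m)); lra.
have := sumE n; rewrite (sumE n.+1) -(addn2 n) => h.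
apply/eqP; rewrite -(eqrXn2 (n := 2)) ?ltW //; apply/eqP; lra.
Qed.

(** All nonzero closed gaps have a common square, so that besides 0 there are
    at most the two opposite values. *)
Lemma g_ODJM_le3 a : positive_vec a -> irreducible_vec a -> (g_ODJM a <= 3)%N.
Proof.
move=> a_gt0 a_irr; apply: card_fset_set_le; first exact: finite_closed_gaps.
move=> s s_uniq gaps.
have [/hasP[x0 x0s x0_neq0]|/hasPn s0] := boolP (has (fun x => x != 0) s).
  apply: (@uniq_leq_size _ s [:: 0; x0; - x0]) => // x xs.
  rewrite !inE; have [//|x_neq0 /=] := eqVneq x 0.
  rewrite -eqf_sqr; apply/eqP.
  exact: odjm_closed_gap_sqr a_gt0 a_irr (gaps x xs) (gaps x0 x0s) _ _.
apply: (@leq_trans 1) => //; apply: (@uniq_leq_size _ s [:: 0]) => // x xs.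
by rewrite inE; have := s0 x xs; rewrite negbK.
Qed.
End UpperBounds.

(** * Examples attaining the bounds *)

Section Examples.
Context {R : realType}.
Implicit Types (a v : 'rV[R]_6) (s x z : R).

Lemma irreducible_vec_noperiod v :
  (forall k, (0 < k < 6)%N -> exists n, v~(n + k) != v~n) -> irreducible_vec v.
Proof.
move=> noper; suff inj (k l : 'I_6) : (k < l)%N -> iter k cyc v <> iter l cyc v.
  move=> k l /= kl; apply/val_inj/eqP; apply: contraPT kl => /=.
  by rewrite neq_ltn => /orP[/inj //|/inj h /esym].
move=> kl eq_kl; have [|n] := noper (l - k)%N; first by have := ltn_ord l; lia.
have := congr1 (fun u => u~(n + (6 - k))) eq_kl; rewrite !periodic_ext_iter_cyc.
have k6 := ltn_ord k; rewrite (_ : n + (6 - k) + k = n + 6)%N; last by lia.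
rewrite (_ : n + (6 - k) + l = n + (l - k) + 6)%N; last by lia.
by rewrite !periodic_extD6 => ->; rewrite eqxx.
Qed.

Lemma horner_eigenvalues a v t x :
  \prod_(z <- eigenvalues (floquet a v t)) (x - z) =
  (floquet_poly a v (cos (2 * pi * t))).[x].
Proof.
rewrite -prod_eigenvalues_floquet horner_prod.
by apply: eq_bigr => z _; rewrite hornerXsubC.
Qed.

Lemma floquet_alternating a v t (c : seq R) : size c = 7%N -> sorted <=%R c ->
  (forall k, (k <= 6)%N ->
    0 < (-1) ^+ (6 - k) * (floquet_poly a v (cos (2 * pi * t))).[c`_k]) ->
  forall k, (k < 6)%N -> c`_k < (eigenvalues (floquet a v t))`_k <= c`_k.+1.
Proof.
have sz : size (eigenvalues (floquet a v t)) = 6%N.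
  by rewrite size_eigenvalues //; exact: floquet_hermitian.
move=> sz_c c_sorted alt; rewrite -{1}sz; apply: alternating_interlace => //.
- exact: eigenvalues_sorted.
- by rewrite sz.
- by move=> k; rewrite sz horner_eigenvalues; exact: alt.
Qed.

(** This is the solution d_0 d_1 = d_1 d_2 = d_2 d_3 = 0 of the equations for
    two closed gaps with s = 1, centered at 0. The value 3/2 makes the simple
    roots of the periodic characteristic polynomial rational. *)
Definition dso_example : 'rV[R]_6 :=
  \row_k [:: 0; 0; 3 / 2; 0; 0; - (3 / 2)]`_k.

Lemma dso_example_ext n : dso_example~n =
  [:: 0; 0; 3 / 2; 0; 0; - (3 / 2)]`_(n %% 6).
Proof. by rewrite /periodic_ext mxE inordK // ltn_mod. Qed.

Lemma dso_example_irreducible : irreducible_vec dso_example.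
Proof.
apply: irreducible_vec_noperiod => k k6; exists 2%N; rewrite !dso_example_ext.
by move: k6; do 6?[case: k => [|k]] => //= _; apply/eqP; lra.
Qed.

Lemma floquet_poly_dso_example c :
  floquet_poly (const_mx 1) dso_example c =
  ('X^2 - 1) ^+ 2 * ('X^2 - (25 / 4)%:P) + (2 * (1 - c))%:P.
Proof.
have e1 n : (const_mx 1 : 'rV[R]_6)~n = 1 by rewrite /periodic_ext mxE.
rewrite /floquet_poly /cyclic_det /= !dso_example_ext /= !e1.
have -> : 25 / 4 = 4 + (3 / 2) ^+ 2 :> R by lra.
rewrite !(polyC_natr, polyCD, polyCN, polyCM, polyC0, polyC1, polyC_exp).
ring.
Qed.

Lemma dso_example_gaps t
    (e := eigenvalues (floquet (const_mx 1) dso_example t)) :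
  [/\ e`_1 <= - 1, - 1 <= e`_2, e`_3 <= 1 & 1 <= e`_4] /\
  (cos (2 * pi * t) = 1 -> [/\ e`_1 = - 1, e`_2 = - 1, e`_3 = 1 & e`_4 = 1]).
Proof.
have := floquet_poly_dso_example (cos (2 * pi * t)).
have := cos_geN1 (2 * pi * t); have := cos_le1 (2 * pi * t).
set c := cos _ => c1 cN1 PE.
have [cE|c_neq1] := eqVneq c 1.
  (* The phase 0: the polynomial is (X^2 - 1)^2 (X^2 - 25/4). *)
  suff -> : e = [:: - (5 / 2); - 1; - 1; 1; 1; 5 / 2].
    by split=> //; split=> /=; lra.
  apply: eigenvalues_floquet_eq; first by rewrite /=; lra.
  rewrite -/c PE cE !big_cons big_nil.
  have -> : 25 / 4 = (5 / 2) ^+ 2 :> R by lra.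
  rewrite !(polyCD, polyCN, polyCM, polyC0, polyC1, polyC_exp).
  ring.
have {}c1 : c < 1 by rewrite lt_neqAle c_neq1.
(* At other phases the term 2 (1 - c) lifts the double roots -1 and 1 off the
   axis, and the polynomial alternates in sign at these seven points. *)
pose pts : seq R := [:: -3; -2; -1; 0; 1; 2; 3].
have alt : forall k, (k < 6)%N -> pts`_k < e`_k <= pts`_k.+1.
  apply: floquet_alternating => //=; first by lra.
  move=> k; rewrite -/c PE !(hornerE, hornerXn).
  by do 7?[case: k => [|k]] => //= _;
    rewrite -?[(-1) ^+ (6 - _)]signr_odd /= ?expr0 ?expr1 ?mul1r; lra.
split; last by move/eqP; rewrite (negPf c_neq1).
have /andP[_ h1] := alt 1%N isT; have /andP[h2 _] := alt 2%N isT.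
have /andP[_ h3] := alt 3%N isT; have /andP[h4 _] := alt 4%N isT.
by split; [exact: h1|exact: ltW h2|exact: h3|exact: ltW h4].
Qed.

Lemma cos0_1 : cos (2 * pi * 0) = 1 :> R.
Proof. by rewrite mulr0 cos0. Qed.

Lemma cos_half : cos (2 * pi * 2^-1) = - 1 :> R.
Proof. by rewrite mulrAC divff ?mul1r ?cospi. Qed.

Lemma g_DSO_example : (2 <= g_DSO dso_example)%N.
Proof.
have distinct : uniq [:: - 1; 1 : R].
  by rewrite /= inE andbT; apply/eqP; lra.
have unit0 : 0 <= (0 : R) <= 1 by rewrite lexx ler01.
have [_ /(_ cos0_1) [e1 e2 e3 e4]] := dso_example_gaps 0.
apply: (card_fset_set_ge (finite_closed_gaps _ _) distinct) => x.
rewrite !inE => /orP[] /eqP ->.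
  apply: (closed_gapI (j := 1) isT unit0 e1 e2) => t.
  by have [[h1 h2 _ _] _] := dso_example_gaps t; rewrite h1 h2.
apply: (closed_gapI (j := 3) isT unit0 e3 e4) => t.
by have [[_ _ h3 h4] _] := dso_example_gaps t; rewrite h3 h4.
Qed.

(** For a = (p, q, r, r, q, p) the two products of alternate entries agree,
    which closes the gap at 0, and the conditions for a periodic closed gap
    reduce to 2 / q^2 = 1 / p^2 + 1 / r^2, with x^2 = q^2. Up to scaling by 35
    this is 2 * 5^2 = 1^2 + 7^2. *)
Definition odjm_example : 'rV[R]_6 := \row_k [:: 35; 7; 5; 5; 7; 35]`_k.

Lemma odjm_example_ext n : odjm_example~n = [:: 35; 7; 5; 5; 7; 35]`_(n %% 6).
Proof. by rewrite /periodic_ext mxE inordK // ltn_mod. Qed.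

Lemma odjm_example_gt0 : positive_vec odjm_example.
Proof. by move=> [[|[|[|[|[|[|k]]]]]] k6] //; rewrite mxE /=; lra. Qed.

Lemma odjm_example_irreducible : irreducible_vec odjm_example.
Proof.
apply: irreducible_vec_noperiod => k k6; exists (k == 5 :> nat)%N.
rewrite !odjm_example_ext.
by move: k6; do 6?[case: k => [|k]] => //= _; apply/eqP; lra.
Qed.

Lemma floquet_poly_odjm_example c :
  floquet_poly odjm_example 0 c =
  ('X^2 - (7 ^+ 2)%:P) ^+ 2 * ('X^2 - (50 ^+ 2)%:P)
  + (2 * (1 - c) * (35 ^+ 2) ^+ 2)%:P.
Proof.
have e0 n : (0 : 'rV[R]_6)~n = 0 by rewrite /periodic_ext mxE.
rewrite /floquet_poly /cyclic_det /= !odjm_example_ext /= !e0.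
rewrite !(polyC_natr, polyCD, polyCN, polyCM, polyC0, polyC1, polyC_exp).
ring.
Qed.

Lemma odjm_example_gaps t (e := eigenvalues (floquet odjm_example 0 t)) :
  [/\ e`_1 <= - 7, - 7 <= e`_2 <= 0, 0 <= e`_3 <= 7 & 7 <= e`_4] /\
  (cos (2 * pi * t) = 1 -> [/\ e`_1 = - 7, e`_2 = - 7, e`_3 = 7 & e`_4 = 7]) /\
  (cos (2 * pi * t) = - 1 -> e`_2 = 0 /\ e`_3 = 0).
Proof.
have := floquet_poly_odjm_example (cos (2 * pi * t)).
have := cos_geN1 (2 * pi * t); have := cos_le1 (2 * pi * t).
set c := cos _ => c1 cN1 PE.
have [cE|c_neq1] := eqVneq c 1.
  suff -> : e = [:: - 50; - 7; - 7; 7; 7; 50].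
    by split; [split=> /=; lra|split=> //; rewrite cE; lra].
  apply: eigenvalues_floquet_eq; first by rewrite /=; lra.
  rewrite -/c PE cE !big_cons big_nil.
  rewrite !(polyC_natr, polyCD, polyCN, polyCM, polyC0, polyC1, polyC_exp).
  ring.
have [cE|c_neqN1] := eqVneq c (- 1).
  (* The antiperiodic phase: the polynomial is X^2 (X^2 - 99) (X^2 - 2499). *)
  pose q : R := Num.sqrt (10 ^+ 2 - 1); pose r : R := Num.sqrt (50 ^+ 2 - 1).
  have q2 : q ^+ 2 = 10 ^+ 2 - 1 by apply: sqr_sqrtr; lra.
  have r2 : r ^+ 2 = 50 ^+ 2 - 1 by apply: sqr_sqrtr; lra.
  have q0 : 0 <= q by exact: sqrtr_ge0.
  have r0 : 0 <= r by exact: sqrtr_ge0.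
  have q7 : 7 <= q by nra.
  have qr : q <= r by nra.
  suff -> : e = [:: - r; - q; 0; 0; q; r].
    by split; [split=> /=; lra|split=> //; rewrite cE; lra].
  apply: eigenvalues_floquet_eq; first by rewrite /=; lra.
  rewrite -/c PE cE !big_cons big_nil.
  have q2P : q%:P ^+ 2 = 10 ^+ 2 - 1.
    by rewrite -polyC_exp q2 polyCB polyC_exp polyC_natr.
  have r2P : r%:P ^+ 2 = 50 ^+ 2 - 1.
    by rewrite -polyC_exp r2 polyCB polyC_exp polyC_natr.
  transitivity ('X ^+ 2 * ('X^2 - q%:P ^+ 2) * ('X^2 - r%:P ^+ 2)); last first.
    by rewrite !(polyCN, polyC0); ring.
  rewrite q2P r2P.
  rewrite !(polyC_natr, polyCD, polyCN, polyCM, polyC0, polyC1, polyC_exp).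
  ring.
have {}c1 : c < 1 by rewrite lt_neqAle c_neq1.
have {}cN1 : - 1 < c by rewrite lt_neqAle eq_sym c_neqN1.
(* At other phases neither -7, 7 nor 0 is a root any more, and the polynomial
   alternates in sign at these seven points. *)
pose pts : seq R := [:: -51; -10; -7; 0; 7; 10; 51].
have alt : forall k, (k < 6)%N -> pts`_k < e`_k <= pts`_k.+1.
  apply: floquet_alternating => //=; first by lra.
  move=> k; rewrite -/c PE !(hornerE, hornerXn).
  by do 7?[case: k => [|k]] => //= _;
    rewrite -?[(-1) ^+ (6 - _)]signr_odd /= ?expr0 ?expr1 ?mul1r; lra.
split; last by split; move/eqP; rewrite ?(negPf c_neq1) ?(negPf c_neqN1).
have /andP[_ h1] := alt 1%N isT; have /andP[h2 h2'] := alt 2%N isT.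
have /andP[h3' h3] := alt 3%N isT; have /andP[h4 _] := alt 4%N isT.
split; [exact: h1|apply/andP|apply/andP|exact: ltW h4].
  by split; [exact: ltW h2|exact: h2'].
by split; [exact: ltW h3'|exact: h3].
Qed.

Lemma g_ODJM_example : (3 <= g_ODJM odjm_example)%N.
Proof.
have distinct : uniq [:: - 7; 0; 7 : R].
  rewrite /= !inE negb_or !andbT -andbA.
  by apply/and3P; split; apply/eqP; lra.
have unit0 : 0 <= (0 : R) <= 1 by rewrite lexx ler01.
have unit_half : 0 <= (2^-1 : R) <= 1 by apply/andP; split; lra.
have [_ [/(_ cos0_1) [e1 e2 e3 e4] _]] := odjm_example_gaps 0.
have [_ [_ /(_ cos_half) [f2 f3]]] := odjm_example_gaps 2^-1.
apply: (card_fset_set_ge (finite_closed_gaps _ _) distinct) => x.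
rewrite !inE => /or3P[] /eqP ->.
- apply: (closed_gapI (j := 1) isT unit0 e1 e2) => t.
  by have [[h1 /andP[h2 _] _ _] _] := odjm_example_gaps t; rewrite h1 h2.
- apply: (closed_gapI (j := 2) isT unit_half f2 f3) => t.
  have [[_ /andP[_ h2] /andP[h3 _] _] _] := odjm_example_gaps t.
  by rewrite h2 h3.
- apply: (closed_gapI (j := 3) isT unit0 e3 e4) => t.
  by have [[_ _ /andP[_ h3] h4] _] := odjm_example_gaps t; rewrite h3 h4.
Qed.
End Examples.

Theorem theorem1p11 (R : realType) :
  is_max [set g_DSO v | v in [set v : 'rV[R]_6 | irreducible_vec v]] 2%N
  /\
  is_max [set g_ODJM a |
    a in [set a : 'rV[R]_6 | positive_vec a /\ irreducible_vec a]] 3%N.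
Proof.
split; split.
- exists dso_example; first exact: dso_example_irreducible.
  apply/eqP; rewrite eqn_leq g_DSO_le2 ?g_DSO_example //.
  exact: dso_example_irreducible.
- by move=> _ [v v_irr <-]; exact: g_DSO_le2.
- have pos := odjm_example_gt0 (R := R).
  have irr := odjm_example_irreducible (R := R).
  exists odjm_example; first by split.
  by apply/eqP; rewrite eqn_leq g_ODJM_le3 ?g_ODJM_example.
- by move=> _ [a [a_gt0 a_irr] <-]; exact: g_ODJM_le3.
Qed.
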